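(* Let $\ell,n,m\in\mathbb{N}^*=\{1,2,\dots\}$. The set $$S=\left\{(E,A,B)\in\Sigma_{\ell,n,m}\;\middle|\;\text{the system } \tfrac{\mathrm{d}}{\mathrm{d}t}(Ex)=Ax+Bu \text{ is completely controllable}\right\}$$ is generic if, and only if, $\ell<n+m$.
   Context: $\Sigma_{\ell,n,m}:=\mathbb{R}^{\ell\times n}\times\mathbb{R}^{\ell\times n}\times\mathbb{R}^{\ell\times m}$, identified with $\mathbb{R}^{2\ell n+\ell m}$ by listing matrix entries. A set $\mathbb{V}\subseteq\mathbb{R}^N$ is an algebraic variety if it is the set of common zeros of finitely many polynomials in $\mathbb{R}[x_1,\dots,x_N]$; it is proper if $\mathbb{V}\neq\mathbb{R}^N$. A set $S\subseteq\mathbb{R}^N$ is generic if its complement is contained in some proper algebraic variety. A mapping $(x,u):\mathbb{R}\to\mathbb{R}^n\times\mathbb{R}^m$ is a solution of $\tfrac{\mathrm{d}}{\mathrm{d}t}(Ex)=Ax+Bu$ if $x\in\mathcal{L}^1_{\mathrm{loc}}(\mathbb{R},\mathbb{R}^n)$, $u\in\mathcal{L}^1_{\mathrm{loc}}(\mathbb{R},\mathbb{R}^m)$ (locally integrable functions), $Ex:\mathbb{R}\to\mathbb{R}^\ell$ is (locally) absolutely continuous, and $\tfrac{\mathrm{d}}{\mathrm{d}t}(Ex)(t)=Ax(t)+Bu(t)$ for all $t$ outside a Lebesgue nullset. The set of all solutions is denoted $\mathfrak{B}_{[E,A,B]}$. The system $(E,A,B)$ is completely controllable if there exists $T>0$ such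 that for all $x_0,x_T\in\mathbb{R}^n$ there exists $(x,u)\in\mathfrak{B}_{[E,A,B]}$ with $x(0)=x_0$ and $x(T)=x_T$. *)

(* Defs.v *)
From HB Require Import structures.
From mathcomp Require Import all_boot all_order all_algebra.
From mathcomp Require Import all_classical all_reals all_analysis.
From mathcomp Require mpoly.
Import Order.TTheory GRing.Theory Num.Theory.
Import numFieldNormedType.Exports.

Set Implicit Arguments.
Unset Strict Implicit.
Unset Printing Implicit Defensive.

Local Open Scope classical_set_scope.
Local Open Scope ring_scope.

Definition algebraic_variety (R : realType) (N : nat) (V : set 'rV[R]_N) : Prop :=
  exists (k : nat) (p : 'I_k -> mpoly.mpoly N R),
    V = [set v : 'rV[R]_N | forall i, mpoly.meval (v 0) (p i) = 0].

Definition generic (R : realType) (N : nat) (S : set 'rV[R]_N) : Prop :=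
  exists V : set 'rV[R]_N,
    [/\ algebraic_variety V, V <> setT & ~` S `<=` V].

Definition Sigma (R : realType) (l n m : nat) : Type :=
  ('M[R]_(l, n) * 'M[R]_(l, n) * 'M[R]_(l, m))%type.

(* [mxvec] lists the entries of a matrix row by row; this is a bijection from
   Sigma R l n m onto R^(2ln + lm). *)
Definition Sigma_vec (R : realType) (l n m : nat) (s : Sigma R l n m) :
    'rV[R]_(l * n + l * n + l * m) :=
  row_mx (row_mx (mxvec s.1.1) (mxvec s.1.2)) (mxvec s.2).

(* Integrability is with respect to the completed Lebesgue measure, so that f
   only has to be Lebesgue measurable; [lebesgue_measure], used by the library's
   [locally_integrable], would require Borel measurability. *)
Definition L1loc (R : realType) (k : nat) (f : R -> 'cV[R]_k) : Prop :=
  forall (i : 'I_k) (K : set R), compact K ->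
    (@completed_lebesgue_measure R).-integrable K (fun t => (f t i 0)%:E).

Definition locally_absolutely_continuous (R : realType) (V : normedModType R)
    (f : R -> V) : Prop :=
  forall c d : R, forall eps : R, 0 < eps ->
    exists2 delta : R, 0 < delta &
      forall (k : nat) (a b : 'I_k -> R),
        (forall i, [/\ c <= a i, a i <= b i & b i <= d]) ->
        trivIset [set: 'I_k] (fun i => `]a i, b i[%classic) ->
        \sum_(i < k) (b i - a i) < delta ->
        \sum_(i < k) `|f (b i) - f (a i)| < eps.

(* Elements of the behavior are functions, not classes modulo null sets: E x is
   absolutely continuous as it stands, and x has a value at every time. *)
Definition behavior (R : realType) (l n m : nat)
    (E A : 'M[R]_(l, n)) (B : 'M[R]_(l, m)) :
    set ((R -> 'cV[R]_n) * (R -> 'cV[R]_m)) :=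
  [set xu | [/\ L1loc xu.1, L1loc xu.2,
     locally_absolutely_continuous (fun t => E *m xu.1 t) &
     {ae (@lebesgue_measure R), forall t : R,
        is_derive t 1 (fun s => E *m xu.1 s) (A *m xu.1 t + B *m xu.2 t)}]].

Definition completely_controllable (R : realType) (l n m : nat)
    (s : Sigma R l n m) : Prop :=
  exists2 T : R, 0 < T &
    forall x0 xT : 'cV[R]_n,
      exists x u, [/\ behavior s.1.1 s.1.2 s.2 (x, u), x 0 = x0 & x T = xT].

(* Main.v *)
(** Suppose l < n + m.  Complete the polynomial matrix [-B, sE - A] to a square
    matrix W(s) by appending rows that do not depend on (E, A, B).  If e is the
    last basis vector, the column b = adj(W) e satisfies [-B, sE - A] b = 0, so
    (u, x) = b(d/dt) y is a solution for every smooth y.  As soon as the first n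
    coefficient vectors of the x-part of b are independent, the values x(0) and
    x(1) can be prescribed by interpolating the derivatives of y at 0 and 1.  The
    determinant of these vectors is a polynomial in the entries of (E, A, B), and
    it is nonzero when W(s) is the block diagonal matrix of 1 and s - shift.

    Suppose n + m <= l.  If [E, B] has a left inverse, whose first n rows we call
    L, then x = L E x is absolutely continuous and x' = L A x almost everywhere,
    so x(0) = 0 forces x = 0.  No proper variety contains all such systems:
    on a line joining a point outside the variety to a system with
    [E, B] left invertible, both conditions exclude finitely many points only. *)

Require Import Defs.
From mathcomp Require Import all_boot all_order all_algebra.
From mathcomp Require Import -(notations) mpoly.
From mathcomp Require Import all_classical all_reals all_analysis measurable_realfun.
From mathcomp Require Import lra ring.
Import Order.TTheory GRing.Theory Num.Theory.
Import numFieldNormedType.Exports.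

Set Implicit Arguments.
Unset Strict Implicit.
Unset Printing Implicit Defensive.

Local Open Scope classical_set_scope.
Local Open Scope ring_scope.

(** * The pencil and its polynomial kernel vector *)

Section Pencil.
Variables (T : comNzRingType) (l n m : nat).

(** The lower block is sI - N with N the nilpotent shift. This matrix fills the missing rows of the
    pencil and is also the reference point at which the determinant [x_coef_det] equals 1. *)
Definition shift_pencil : 'M[{poly T}]_(m + n) :=
  block_mx 1%:M 0 0 ('X%:M - \matrix_(i, j) (j == i.+1 :> nat)%:R).

(** The index type is not syntactically a successor, so the last index is singled out by an equation
    instead of [ord_max]. *)
Definition last_col : 'cV[{poly T}]_(m + n) :=
  \col_i (i.+1 == m + n)%N%:R.

Definition pencil (E A : 'M[T]_(l, n)) (B : 'M[T]_(l, m)) :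
    'M[{poly T}]_(l, m + n) :=
  row_mx (- map_mx polyC B) ('X *: map_mx polyC E - map_mx polyC A).

(* The first l rows are those of the pencil, the others those of shift_pencil. *)
Definition square_pencil E A B : 'M[{poly T}]_(m + n) :=
  pid_mx l *m pencil E A B + copid_mx l *m shift_pencil.

Definition image_col E A B : 'cV[{poly T}]_(m + n) :=
  \adj (square_pencil E A B) *m last_col.

(* With image_col = sum_j s^j (u_coef j; x_coef j), a smooth y gives the solution
   u = sum_j y^(j) u_coef j, x = sum_j y^(j) x_coef j. *)
Definition u_coef E A B (j : nat) : 'cV[T]_m :=
  map_mx (coefp j) (usubmx (image_col E A B)).

Definition x_coef E A B (j : nat) : 'cV[T]_n :=
  map_mx (coefp j) (dsubmx (image_col E A B)).

Definition x_coef_det E A B : T := \det (\matrix_(i < n, j < n) x_coef E A B j i 0).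

(** W adj(W) e = det(W) e, and the rows of the pencil are the first l rows of W, where e vanishes
    because l < m + n. *)
Lemma pencil_image_col E A B : (l < m + n)%N ->
  pencil E A B *m image_col E A B = 0.
Proof.
move=> lmn; set Q : 'M[{poly T}]_(l, m + n) := pid_mx l.
have QW : Q *m square_pencil E A B = pencil E A B.
  rewrite mulmxDr !mulmxA pid_mx_id ?(ltnW lmn)// pid_mx_1 mul1mx.
  by rewrite mul_pid_mx_copid ?(ltnW lmn)// mul0mx addr0.
rewrite -QW /image_col mulmxA -(mulmxA Q) mul_mx_adj -mulmxA mul_scalar_mx.
rewrite -scalemxAr; apply/matrixP => i j; rewrite !mxE big1 ?mulr0// => k _.
rewrite !mxE; case: eqVneq => [ik|]; last by rewrite mul0r.
by rewrite -ik ltn_eqF ?mulr0// (leq_ltn_trans _ lmn).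
Qed.

Lemma coefp_mulmxC p q (M : 'M[T]_(p, q)) (v : 'cV[{poly T}]_q) j :
  map_mx (coefp j) (map_mx polyC M *m v) = M *m map_mx (coefp j) v.
Proof.
apply/matrixP => r c; rewrite !mxE /= coef_sum.
by apply: eq_bigr => k _; rewrite !mxE coefCM.
Qed.

(** Comparison of the coefficients of s^j in (sE - A) x = B u; the factor s lowers the index on the
    left by one. *)
Lemma x_coef_rec E A B j : (l < m + n)%N ->
  E *m (if j is i.+1 then x_coef E A B i else 0) =
  A *m x_coef E A B j + B *m u_coef E A B j.
Proof.
move=> lmn; have := pencil_image_col E A B lmn.
rewrite -{1}(vsubmxK (image_col E A B)) mul_row_col mulNmx mulmxBl -scalemxAl.
rewrite addrCA -opprD => /subr0_eq /(congr1 (map_mx (coefp j))).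
rewrite map_mxD !coefp_mulmxC [RHS]addrC => <-.
case: j => [|j]; last rewrite -coefp_mulmxC.
  by rewrite mulmx0; apply/matrixP => r c; rewrite !mxE /= coefXM.
by apply/matrixP => r c; rewrite !mxE /= coefXM.
Qed.

(** The bound is padded by n so that sums over j < d include the first n coefficient vectors. *)
Lemma image_col_coef_finite E A B : exists d, (n <= d)%N /\
  forall j, (d <= j)%N -> x_coef E A B j = 0 /\ u_coef E A B j = 0.
Proof.
pose s := (\sum_i size (image_col E A B i ord0))%N.
have h i j : (n + s <= j)%N -> (image_col E A B i 0)`_j = 0.
  move=> sj; apply: nth_default; apply: leq_trans (leq_trans (leq_addl _ _) sj).
  by rewrite /s (bigD1 i)//= leq_addr.
exists (n + s)%N; split; first exact: leq_addr.
by move=> j sj; split; apply/colP => i; rewrite 2!mxE [RHS]mxE /= h.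
Qed.

End Pencil.

(** The construction commutes with ring morphisms. With f an evaluation of multivariate polynomials,
    the determinant formed from indeterminates specializes to that of each system. *)
Lemma map_image_col (T T' : comNzRingType) (f : {rmorphism T -> T'}) l n m
    (E A : 'M[T]_(l, n)) (B : 'M[T]_(l, m)) :
  map_mx (map_poly f) (image_col E A B) =
  image_col (map_mx f E) (map_mx f A) (map_mx f B).
Proof.
have mC (p q : nat) (M : 'M[T]_(p, q)) :
    map_mx (map_poly f) (map_mx polyC M) = map_mx polyC (map_mx f M).
  by apply/matrixP => i j; rewrite !mxE/= map_polyC.
rewrite /image_col map_mxM map_mx_adj /square_pencil map_mxD !map_mxM.
rewrite map_pid_mx map_copid_mx /pencil map_row_mx map_mxN map_mxB map_mxZ !mC.
have mS : map_mx (map_poly f) (\matrix_(i < n, j < n) (j == i.+1 :> nat)%:R) =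
    \matrix_(i < n, j < n) (j == i.+1 :> nat)%:R :> 'M[{poly T'}]_n.
  by apply/matrixP => i j; rewrite !mxE rmorph_nat.
have mL : map_mx (map_poly f) (last_col T n m) = last_col T' n m.
  by apply/matrixP => i j; rewrite !mxE rmorph_nat.
rewrite mL /= map_polyX /shift_pencil map_block_mx map_mx1 !map_mx0 map_mxB mS.
by rewrite map_scalar_mx /= map_polyX.
Qed.

Lemma map_x_coef (T T' : comNzRingType) (f : {rmorphism T -> T'}) l n m
    (E A : 'M[T]_(l, n)) (B : 'M[T]_(l, m)) j :
  map_mx f (x_coef E A B j) = x_coef (map_mx f E) (map_mx f A) (map_mx f B) j.
Proof.
rewrite /x_coef -map_image_col -map_dsubmx -!map_mx_comp.
by apply: eq_map_mx => p; rewrite /= coef_map.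
Qed.

Lemma map_x_coef_det (T T' : comNzRingType) (f : {rmorphism T -> T'}) l n m
    (E A : 'M[T]_(l, n)) (B : 'M[T]_(l, m)) :
  f (x_coef_det E A B) = x_coef_det (map_mx f E) (map_mx f A) (map_mx f B).
Proof.
rewrite /x_coef_det -det_map_mx; congr (\det _).
apply/matrixP => i j; rewrite mxE [in LHS]mxE [RHS]mxE.
by rewrite -map_x_coef [RHS]mxE.
Qed.

Lemma x_coef_det_neq0 (F : fieldType) l n m : (0 < n)%N -> (l < m + n)%N ->
  exists (E A : 'M[F]_(l, n)) (B : 'M[F]_(l, m)), x_coef_det E A B != 0.
Proof.
move=> n0 lmn; pose Q : 'M[F]_(l, m + n) := pid_mx l.
pose S : 'M[F]_n := \matrix_(i, j) (j == i.+1 :> nat)%:R.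
(* The pencil of this system consists of the first l rows of [shift_pencil], so the completion W is
   [shift_pencil] itself. The sign of B cancels the one in [pencil]. *)
exists (Q *m col_mx 0 1%:M), (Q *m col_mx 0 S), (- (Q *m col_mx 1%:M 0)).
set E := Q *m _; set A := Q *m _; set B := - _.
pose QX : 'M[{poly F}]_(l, m + n) := pid_mx l.
have QE : map_mx polyC Q = QX by rewrite map_pid_mx.
have SE : map_mx polyC S = \matrix_(i, j) (j == i.+1 :> nat)%:R.
  by apply/matrixP => i j; rewrite !mxE rmorph_nat.
have WE : square_pencil E A B = shift_pencil F n m.
  have PE : pencil E A B = QX *m shift_pencil F n m.
    rewrite /pencil map_mxN opprK !map_mxM QE !map_col_mx !map_mx0 !map_mx1.
    rewrite scalemxAr -mulmxBr -mul_mx_row /shift_pencil block_mxEv.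
    rewrite scale_col_mx scaler0 opp_col_mx add_col_mx oppr0 addr0 scalemx1 SE.
    by rewrite /block_mx -block_mxEh block_mxEv.
  rewrite /square_pencil PE mulmxA pid_mx_id// -mulmxDl.
  by rewrite /copid_mx addrC subrK mul1mx.
have detW : \det (shift_pencil F n m) = 'X^n.
  rewrite /shift_pencil det_ublock det1 mul1r -det_tr det_trig.
    transitivity (\prod_(i < n) ('X : {poly F})); last by rewrite prodr_const card_ord.
    by apply: eq_bigr => i _; rewrite !mxE eqxx (ltn_eqF (ltnSn i)) subr0.
  apply/is_trig_mxP => i j ij; rewrite !mxE -val_eqE /= (gtn_eqF ij) (ltn_eqF (ltnW _))//.
  by rewrite subr0.
(* Each row of sI - N maps (1, s, ..., s^(n-1)) to s^(k+1) - s^(k+1) = 0, except the last row, which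
   gives s^n. *)
pose b : 'cV[{poly F}]_(m + n) := col_mx 0 (\col_i 'X^i).
have Wb : shift_pencil F n m *m b = 'X^n *: last_col F n m.
  rewrite /shift_pencil mul_block_col mul1mx !mul0mx addr0 add0r.
  apply/colP => i; rewrite !mxE; case: splitP => k ik; rewrite !mxE.
    by rewrite ik ltn_eqF ?mulr0// (leq_ltn_trans (ltn_ord k))// -[ltnLHS]addn0 ltn_add2l.
  rewrite (bigD1 k)//= !mxE eqxx (ltn_eqF (ltnSn k)) subr0 mulr1n -exprS.
  rewrite ik -addnS eqn_add2l.
  have [kn|kn] := eqVneq k.+1 n.
    rewrite big1 ?addr0 ?mulr1 ?kn// => j jk; rewrite !mxE eq_sym (negPf jk).
    by rewrite kn ltn_eqF// subr0 mul0r.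
  have kn' : (k.+1 < n)%N by rewrite ltn_neqAle kn ltn_ord.
  rewrite (bigD1 (Ordinal kn'))/=; last by rewrite -val_eqE/= gtn_eqF.
  rewrite !mxE -val_eqE /= eqxx ltn_eqF// sub0r mulN1r addrA subrr add0r mulr0.
  rewrite big1// => j /andP[jk]; rewrite -val_eqE/= => jk1; rewrite !mxE eq_sym (negPf jk).
  by rewrite (negPf jk1) subr0 mul0r.
have -> : x_coef_det E A B = 1; last exact: oner_neq0.
have bE : image_col E A B = b.
  (* Evaluate adj(W) W b in two ways, by W b = s^n e and by adj(W) W = s^n; then s^n cancels. *)
  have : 'X^n *: image_col E A B = 'X^n *: b.
    transitivity (\adj (shift_pencil F n m) *m (shift_pencil F n m *m b)).
      by rewrite Wb -scalemxAr /image_col WE.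
    by rewrite mulmxA mul_adj_mx mul_scalar_mx detW.
  move=> /matrixP H; apply/matrixP => i j; have := H i j; rewrite [LHS]mxE [RHS]mxE.
  by apply: mulfI; rewrite expf_neq0// polyX_eq0.
rewrite /x_coef_det -[RHS](det1 F n); congr (\det _); apply/matrixP => i j.
rewrite mxE /x_coef bE col_mxKd [LHS]mxE [RHS]mxE mxE /=.
by rewrite coefXn eq_sym.
Qed.

(** * Hermite interpolation *)

(** Each derivative removes one factor X - a. Only the value of the cofactor at a is tracked, since
    the remaining Leibniz terms keep an additional factor X - a. *)
Lemma derivn_rootM (T : comNzRingType) (a : T) d (s : {poly T}) i : (i <= d)%N ->
  exists s', (('X - a%:P) ^+ d * s)^`(i) = ('X - a%:P) ^+ (d - i) * s' /\
             s'.[a] = (d ^_ i)%:R * s.[a].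
Proof.
elim: i => [|i IHi] id; first by exists s; rewrite derivn0 subn0 ffactn0 mul1r.
have [s' [e1 e2]] := IHi (ltnW id).
exists (s' *+ (d - i) + ('X - a%:P) * s'^`()); split.
  rewrite derivnS e1 derivM deriv_exp derivB derivX derivC subr0 mul1r.
  rewrite -(subnSK id) /= exprSr [RHS]mulrDr [in RHS]mulrA.
  by congr (_ + _); rewrite mulrnAl mulrnAr.
rewrite ffactnSr hornerD hornerMn e2 hornerM hornerXsubC subrr mul0r addr0.
by rewrite natrM mulrAC mulr_natr.
Qed.

Lemma derivn_rootM_lt (T : comNzRingType) (a : T) d (s : {poly T}) i :
  (i < d)%N -> (('X - a%:P) ^+ d * s)^`(i).[a] = 0.
Proof.
move=> id; have [s' [-> _]] := derivn_rootM a s (ltnW id).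
by rewrite hornerM horner_exp hornerXsubC subrr -(subnSK id) exprS !mul0r.
Qed.

Lemma derivn_rootM_eq (T : comNzRingType) (a : T) d (s : {poly T}) :
  (('X - a%:P) ^+ d * s)^`(d).[a] = d`!%:R * s.[a].
Proof.
have [s' [-> e]] := derivn_rootM a s (leqnn d).
by rewrite subnn expr0 mul1r e ffactnn.
Qed.

Lemma hermite_interpolation (F : numFieldType) (a b : F) (ca cb : nat -> F) d :
  a != b -> exists p : {poly F},
    forall i, (i < d)%N -> p^`(i).[a] = ca i /\ p^`(i).[b] = cb i.
(* The derivatives of order d are corrected by a multiple of
   ('X - a)^d ('X - b)^d, which leaves the lower ones unchanged. *)
Proof.
move=> ab; elim: d => [|d [p IHp]]; first by exists 0.
have ba0 : b - a != 0 by rewrite subr_eq0 eq_sym.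
have ab0 : a - b != 0 by rewrite subr_eq0.
(* The d-th derivative of (X - a)^d s at a is d! s(a). Hence alpha and beta are the values that the
   multiplier must take at a and b, and r is the affine polynomial taking them. *)
pose alpha := (ca d - p^`(d).[a]) / (d`!%:R * (a - b) ^+ d).
pose beta := (cb d - p^`(d).[b]) / (d`!%:R * (b - a) ^+ d).
pose r := alpha%:P + ((beta - alpha) / (b - a)) *: ('X - a%:P).
have ra : r.[a] = alpha by rewrite !hornerE subrr mulr0 addr0.
have rb : r.[b] = beta by rewrite !hornerE divfK// addrC subrK.
have fact0 : d`!%:R != 0 :> F by rewrite pnatr_eq0 -lt0n fact_gt0.
have ha : d`!%:R * ((a - b) ^+ d * alpha) = ca d - p^`(d).[a].
  by rewrite mulrA mulrC divfK// mulf_neq0 ?expf_neq0.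
have hb : d`!%:R * ((b - a) ^+ d * beta) = cb d - p^`(d).[b].
  by rewrite mulrA mulrC divfK// mulf_neq0 ?expf_neq0.
pose q := ('X - a%:P) ^+ d * (('X - b%:P) ^+ d * r).
have qE : q = ('X - b%:P) ^+ d * (('X - a%:P) ^+ d * r) by rewrite /q mulrCA.
exists (p + q) => i; rewrite ltnS leq_eqVlt derivnD !hornerD => /predU1P[->|id].
  rewrite {1}/q derivn_rootM_eq {1}qE derivn_rootM_eq !hornerM !horner_exp.
  by rewrite !hornerXsubC ra rb ha hb !(addrC _ (_ - _)) !subrK.
rewrite {1}/q derivn_rootM_lt// {1}qE derivn_rootM_lt// !addr0.
exact: IHp.
Qed.

(** * Polynomial trajectories *)

Section PolynomialTrajectories.
Variable R : realType.

Definition poly_curve k (p : 'cV[{poly R}]_k) (t : R) : 'cV[R]_k :=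
  map_mx (horner_eval t) p.

Lemma poly_curve_mulmx k k' (M : 'M[R]_(k', k)) p t :
  M *m poly_curve p t = poly_curve (map_mx polyC M *m p) t.
Proof.
apply/matrixP => i j; rewrite !mxE /horner_eval horner_sum.
by apply: eq_bigr => q _; rewrite !mxE hornerM hornerC.
Qed.

Lemma L1loc_continuous k (f : R -> 'cV[R]_k) :
  (forall i, continuous (fun t => f t i 0)) -> L1loc f.
Proof.
move=> cf i K cK; apply: measurable_bounded_integrable.
- by apply: sub_caratheodory; exact: compact_measurable.
- exact: compact_finite_measure.
(* Continuity gives Borel measurability, which passes to the larger completed sigma-algebra. *)
- move=> _ Y mY; apply: sub_caratheodory.
  have mf : measurable_fun K (fun t => f t i 0).
    by apply: measurable_funTS; exact: continuous_measurable_fun.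
  exact: mf (compact_measurable cK) Y mY.
- have /compact_bounded[M [_ mrt]] : compact ((fun t => f t i 0) @` K).
    by apply: continuous_compact => //; apply: continuous_subspaceT; exact: cf.
  exists M; split; rewrite ?num_real// => M' MM' t Kt.
  exact: (mrt M' MM' (f t i 0) (ex_intro2 _ _ t Kt erefl)).
Qed.

Lemma C1_lipschitz (f df : R -> R) (c d : R) :
  (forall t : R, is_derive t (1 : R) f (df t)) -> continuous df ->
  exists2 L, 0 <= L & forall a b, c <= a -> a <= b -> b <= d ->
    `|f b - f a| <= L * (b - a).
Proof.
move=> fdf cdf; have [M [_ hM]] : bounded_set (df @` `[c, d]).
  apply: compact_bounded; apply: continuous_compact; last exact: segment_compact.
  exact: continuous_subspaceT.
(* Boundedness only provides a bound by every number strictly above M. *)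
exists (`|M| + 1) => [|a b ca ab bd]; first by rewrite addr_ge0.
have cf : {within `[a, b], continuous f}.
  apply: continuous_subspaceT => t; apply/differentiable_continuous.
  exact/derivable1_diffP/(@ex_derive _ _ _ _ _ _ _ (fdf t)).
have [s] := @MVT_segment R f df a b ab (fun x _ => fdf x) cf.
rewrite in_itv/= => /andP[as_ sb] ->; rewrite normrM (ger0_norm (_ : 0 <= b - a)) ?subr_ge0//.
apply: ler_wpM2r; rewrite ?subr_ge0//; apply: hM.
  by rewrite ltr_pwDr// ler_norm.
by exists s => //=; rewrite in_itv/= (le_trans ca)// (le_trans sb).
Qed.

Lemma lipschitz_ac (V : normedModType R) (f : R -> V) :
  (forall c d, exists2 L, 0 <= L & forall a b, c <= a -> a <= b -> b <= d ->
     `|f b - f a| <= L * (b - a)) ->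
  locally_absolutely_continuous f.
Proof.
move=> lf c d e e0; have [L L0 hL] := lf c d.
(* The summand 1 covers the case L = 0. *)
exists (e / (L + 1)); first by rewrite divr_gt0// ltr_wpDl.
move=> q a b hab _ hsum.
apply: (@le_lt_trans _ _ (L * \sum_(i < q) (b i - a i))).
  by rewrite mulr_sumr; apply: ler_sum => i _; case: (hab i) => *; exact: hL.
apply: (@le_lt_trans _ _ ((L + 1) * \sum_(i < q) (b i - a i))).
  rewrite ler_wpM2r ?lerDl// sumr_ge0// => i _; rewrite subr_ge0.
  by case: (hab i).
by rewrite mulrC -ltr_pdivlMr// ltr_wpDl.
Qed.

Lemma poly_curve_lipschitz k (p : 'cV[{poly R}]_k) (c d : R) :
  exists2 L, 0 <= L & forall a b, c <= a -> a <= b -> b <= d ->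
    `|poly_curve p b - poly_curve p a| <= L * (b - a).
Proof.
have /choice[L hL] i : exists L, 0 <= L /\ forall a b, c <= a -> a <= b -> b <= d ->
    `|(p i 0).[b] - (p i 0).[a]| <= L * (b - a).
  have [L L0 hL] := C1_lipschitz c d (is_derive_poly (p i 0)) (@continuous_horner _ _).
  by exists L.
exists (\sum_i L i) => [|a b ca ab bd]; first by apply: sumr_ge0 => i _; case: (hL i).
have sL0 : 0 <= \sum_i L i by apply: sumr_ge0 => i _; case: (hL i).
rewrite /Num.norm/= mx_normrE; apply: bigmax_le => [|[i j] _].
  by rewrite mulr_ge0// subr_ge0.
rewrite (ord1 j) !mxE/=; apply: (le_trans ((hL i).2 a b ca ab bd)).
rewrite ler_wpM2r ?subr_ge0// (bigD1 i)//= lerDl.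
by apply: sumr_ge0 => q _; case: (hL q).
Qed.

Lemma poly_curve_ac k (p : 'cV[{poly R}]_k) :
  locally_absolutely_continuous (poly_curve p).
Proof. by apply: lipschitz_ac => c d; exact: poly_curve_lipschitz. Qed.

Lemma is_derive_poly_curve k (p : 'cV[{poly R}]_k) (t : R) :
  is_derive t 1 (poly_curve p) (poly_curve (map_mx (@deriv R) p) t).
Proof.
have dp i j : is_derive t 1 (fun s => poly_curve p s i j) (p i j)^`().[t].
  have -> : (fun s => poly_curve p s i j) = horner (p i j).
    by apply/funext => s; rewrite mxE.
  exact: is_derive_poly.
have der : derivable (poly_curve p) t 1.
  by apply/derivable_mxP => i j; exact: (@ex_derive _ _ _ _ _ _ _ (dp i j)).
apply: DeriveDef => //; rewrite derive_mx//; apply/matrixP => i j.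
by rewrite !mxE; exact: (@derive_val _ _ _ _ _ _ _ (dp i j)).
Qed.

Lemma poly_curve_behavior l n m (E A : 'M[R]_(l, n)) (B : 'M[R]_(l, m))
    (xp : 'cV[{poly R}]_n) (up : 'cV[{poly R}]_m) :
  map_mx polyC E *m map_mx (@deriv R) xp =
    map_mx polyC A *m xp + map_mx polyC B *m up ->
  behavior E A B (poly_curve xp, poly_curve up).
Proof.
move=> ode.
have cts k (p : 'cV[{poly R}]_k) i : continuous (fun t => poly_curve p t i 0).
  have -> : (fun s => poly_curve p s i 0) = horner (p i 0).
    by apply/funext => s; rewrite mxE.
  exact: continuous_horner.
have Ex : (fun t => E *m poly_curve xp t) = poly_curve (map_mx polyC E *m xp).
  by apply/funext => t; exact: poly_curve_mulmx.
split => /=; [exact: L1loc_continuous..| |].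
  by rewrite Ex; exact: poly_curve_ac.
apply: aeW => t; rewrite Ex.
suff -> : A *m poly_curve xp t + B *m poly_curve up t =
    poly_curve (map_mx (@deriv R) (map_mx polyC E *m xp)) t.
  exact: is_derive_poly_curve.
rewrite !poly_curve_mulmx -[LHS]map_mxD -ode; congr (map_mx _ _).
apply/matrixP => i j; rewrite !mxE (raddf_sum (@deriv R)); apply: eq_bigr => q _.
by rewrite !mxE /= derivM derivC mul0r add0r.
Qed.

Lemma image_representation_controllable l n m (E A : 'M[R]_(l, n)) (B : 'M[R]_(l, m))
    (xc : nat -> 'cV[R]_n) (uc : nat -> 'cV[R]_m) (d : nat) :
  (forall j, E *m (if j is i.+1 then xc i else 0) = A *m xc j + B *m uc j) ->
  (n <= d)%N -> (forall j, (d <= j)%N -> xc j = 0 /\ uc j = 0) ->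
  \det (\matrix_(i < n, j < n) xc j i 0) != 0 ->
  completely_controllable (E, A, B).
Proof.
move=> rec nd xc0 detX; exists 1 => // x0 xT.
set X := \matrix_(i, j) _ in detX.
have uX : X \in unitmx by rewrite unitmxE unitfE.
(* The coordinates of v in the basis of the first n vectors [xc j] are the derivatives of y to
   prescribe; the default 0 prescribes those of order n to d - 1. *)
pose jet (v : 'cV[R]_n) j := if insub j is Some i then (invmx X *m v) i 0 else 0.
have jetE v : \sum_(j < d) jet v j *: xc j = v.
  rewrite -(big_mkord xpredT (fun j => jet v j *: xc j)) (big_cat_nat (n := n))//=.
  rewrite [X in _ + X]big_nat_cond [X in _ + X]big1 ?addr0; last first.
    move=> j /andP[/andP[nj _] _].
    by rewrite /jet insubN ?scale0r// -leqNgt.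
  rewrite big_mkord -[RHS](mulKVmx uX); apply/matrixP => i k.
  rewrite (ord1 k) summxE mxE; apply: eq_bigr => j _.
  by rewrite mxE mxE /jet valK mulrC.
have ne01 : 0 != 1 :> R by rewrite eq_sym oner_eq0.
have [y hy] := hermite_interpolation (jet x0) (jet xT) d ne01.
pose curve k (c : nat -> 'cV[R]_k) : 'cV[{poly R}]_k :=
  \sum_(j < d) y^`(j) *: map_mx polyC (c j).
have curveE k (c : nat -> 'cV[R]_k) t :
    poly_curve (curve k c) t = \sum_(j < d) y^`(j).[t] *: c j.
  apply/matrixP => i j; rewrite mxE !summxE /horner_eval horner_sum.
  by apply: eq_bigr => q _; rewrite !mxE hornerM hornerC.
have curve_deriv k (c : nat -> 'cV[R]_k) : map_mx (@deriv R) (curve k c) =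
    \sum_(j < d) y^`(j.+1) *: map_mx polyC (c j).
  apply/matrixP => i j; rewrite mxE /curve !summxE (raddf_sum (@deriv R)).
  by apply: eq_bigr => q _; rewrite !mxE /= derivM derivC mulr0 addr0.
exists (poly_curve (curve n xc)), (poly_curve (curve m uc)); split.
- apply: poly_curve_behavior; rewrite curve_deriv.
  pose prev j := if j is i.+1 then xc i else 0.
  (* After reindexing, [rec] applies to every term. The new term j = 0 vanishes because [prev 0] is
     0, and the term j = d because [xc d] and [uc d] are 0. *)
  transitivity (\sum_(j < d.+1) y^`(j) *: map_mx polyC (E *m prev j)).
    rewrite big_ord_recl /= mulmx0 map_mx0 scaler0 add0r mulmx_sumr.
    by apply: eq_bigr => j _; rewrite -scalemxAr map_mxM.
  rewrite big_ord_recr /= rec; have [-> ->] := xc0 d (leqnn d).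
  rewrite !mulmx0 addr0 map_mx0 scaler0 addr0 !mulmx_sumr -big_split /=.
  by apply: eq_bigr => j _; rewrite rec map_mxD !map_mxM scalerDr -!scalemxAr.
- rewrite curveE -[RHS]jetE; apply: eq_bigr => j _.
  by have [-> _] := hy j (ltn_ord j).
- rewrite curveE -[RHS]jetE; apply: eq_bigr => j _.
  by have [_ ->] := hy j (ltn_ord j).
Qed.

End PolynomialTrajectories.

(** * Absolutely continuous functions *)

Section AbsolutelyContinuous.
Variable R : realType.

(** The step at the supremum s of the points satisfying P transfers P from a point just left of s to
    one beyond s, unless b is reached. It is stated for pairs p <= s <= q because local information
    at s concerns intervals containing s. *)
Lemma real_induction (P : R -> Prop) a b : a <= b -> P a ->
  (forall s, a <= s <= b -> exists2 eta, 0 < eta & forall p q,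
     a <= p -> s - eta < p -> p <= s -> s <= q -> q < s + eta -> q <= b ->
     P p -> P q) ->
  P b.
Proof.
move=> ab Pa step; pose S := [set t | a <= t <= b /\ P t].
have Sa : S a by split=> //; rewrite lexx.
have hS : has_sup S by split; [exists a|exists b => t [/andP[]]].
set s := sup S.
have as_ : a <= s by apply: ub_le_sup => //; case: hS.
have sb : s <= b by apply: ge_sup; [exists a|move=> t [/andP[]]].
have [eta eta0 heta] := step s (introT andP (conj as_ sb)).
have [p [/andP[ap pb] Pp] sp] := sup_adherent eta0 hS.
have ps : p <= s by apply: ub_le_sup; [case: hS|split=> //; rewrite ap].
have Pmin : P (Num.min b (s + eta / 2)).
  apply: (heta p) => //.
  - by rewrite le_min sb lerDl divr_ge0// ltW.
  - by rewrite gt_min ltrD2l ltr_pdivrMr// ltr_pMr// ltr1n orbT.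
  - by rewrite ge_min lexx.
have : Num.min b (s + eta / 2) <= s.
  apply: ub_le_sup; first by case: hS.
  split=> //; rewrite le_min ab (le_trans as_) ?lerDl ?divr_ge0 ?(ltW eta0)//=.
  by rewrite ge_min lexx.
rewrite ge_min => /orP[bs|]; last by rewrite gerDl leNgt divr_gt0.
by move: Pmin; rewrite min_l// (le_trans bs)// lerDl divr_ge0// ltW.
Qed.

(** A derivative at the single point s controls increments starting or ending at s; the increment
    over [p, q] is split there. *)
Lemma derive_le0_local (f : R -> R) (s d e : R) : is_derive s (1 : R) f d -> d <= 0 -> 0 < e ->
  exists2 eta, 0 < eta & forall p q, s - eta < p -> p <= s -> s <= q ->
    q < s + eta -> f q - f p <= e * (q - p).
Proof.
move=> [df fd] d0 e0.
have : h^-1 *: (f (h *: (1 : R) + s) - f s) @[h --> 0^'] --> d by rewrite -fd; exact: df.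
move=> /cvgrPdist_lt/(_ e e0).
move=> /nbhs_ballP[eta /= eta0 heta]; exists eta => // p q sp ps sq qs.
have key h : h != 0 -> `|h| < eta -> `|f (h + s) - f s - d * h| <= e * `|h|.
  move=> h0 hlt; have := heta h; rewrite /ball/= sub0r normrN => /(_ hlt h0).
  rewrite -[h *: 1]/(h * 1) mulr1 => /ltW H.
  rewrite -[X in X - _](mulVKf h0) (mulrC d) -mulrBr normrM mulrC ler_wpM2r//.
  by rewrite distrC.
have H1 : f q - f s <= e * (q - s).
  have [->|qs0] := eqVneq q s; first by rewrite !subrr mulr0.
  have := key (q - s); rewrite subr_eq0 subrK ger0_norm ?subr_ge0// => /(_ qs0).
  rewrite ltrBlDl => /(_ qs) /ler_normlP[_]; rewrite lerBlDr => /le_trans; apply.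
  by rewrite gerDl mulr_le0_ge0// subr_ge0.
have H2 : f s - f p <= e * (s - p).
  have [->|ps0] := eqVneq p s; first by rewrite !subrr mulr0.
  have := key (p - s); rewrite subr_eq0 subrK distrC ger0_norm ?subr_ge0// => /(_ ps0).
  rewrite ltrBlDl addrC -ltrBlDl => /(_ _)/ler_normlP[]; first by lra.
  move=> + _; nra.
by lra.
Qed.

(* Small intervals around a point where f is differentiable have slope at most e;
   those around an exceptional point lie in an open set of small measure, on which
   absolute continuity bounds the variation of f.  Real induction carries the list
   of intervals of the second kind. *)
Lemma ac_ae_nonincreasing (f : R -> R^o) (a b : R) : a <= b ->
  locally_absolutely_continuous f ->
  {ae (@lebesgue_measure R), forall t : R, exists2 d : R, is_derive t (1 : R) f d & d <= 0} ->
  f b <= f a.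
Proof.
move=> ab acf [N [mN N0 hN]].
apply/ler_addgt0Pr => eps eps0.
(* Chosen so that e (b - a) + e = eps: the first term pays for the slopes, the second for the
   variation on the exceptional intervals. *)
pose e := eps / (b - a + 1).
have ba0 : 0 < b - a + 1 by rewrite ltr_wpDl// subr_ge0.
have e0 : 0 < e by rewrite divr_gt0.
have [delta delta0 hdelta] := acf a b e e0.
have [U [oU NU muU]] : exists U : set R, [/\ open U, N `<=` U &
    (lebesgue_measure U < delta%:E)%E].
  have Nfin : (lebesgue_measure N < +oo)%E by rewrite N0.
  have [U [oU NU muU]] := lebesgue_regularity_outer mN Nfin delta0.
  exists U; split=> //.
  have mU : measurable U by exact: open_measurable.
  have -> : U = (U `\` N) `|` N by rewrite setUC setDUK.
  apply: le_lt_trans muU.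
  rewrite -[leRHS]adde0 -N0; apply: measureU2 => //; exact: measurableD.
have mU : measurable U by exact: open_measurable.
pose mu : measure _ _ := @lebesgue_measure R.
(* The total length is compared with the part of U left of s, so that appending an interval [p, q]
   inside U increases both sides by q - p. Half-open intervals make the two parts of U disjoint. *)
pose P s := exists k (al be : nat -> R),
  [/\ forall i, (i < k)%N -> [/\ a <= al i, al i <= be i & be i <= s],
      forall i j, (i < j)%N -> (j < k)%N -> be i <= al j,
      ((\sum_(0 <= i < k) (be i - al i))%:E <= mu (U `&` `[a, s[%classic))%E &
      f s - f a <= e * (s - a) + \sum_(0 <= i < k) `|f (be i) - f (al i)|].
suff [k [al [be [h1 h2 h3 h4]]]] : P b.
  have : \sum_(0 <= i < k) `|f (be i) - f (al i)| < e.
    rewrite big_mkord; apply: (hdelta k (fun i => al i) (fun i => be i)).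
    - by move=> i; exact: h1.
    - apply/trivIsetP => i j _ _; wlog ij : i j / (i < j)%N => [W|ij'].
        rewrite neq_ltn => /orP[ij|ji]; first by apply: W => //; rewrite neq_ltn ij.
        by rewrite setIC; apply: W => //; rewrite neq_ltn ji.
      rewrite -subset0 => t [/=]; rewrite !in_itv/= => /andP[_ t1] /andP[t2 _].
      by have := lt_le_trans t1 (le_trans (h2 i j ij (ltn_ord j)) (ltW t2)); rewrite ltxx.
    - rewrite -lte_fin -(big_mkord xpredT (fun i => be i - al i)).
      apply: le_lt_trans h3 (le_lt_trans _ muU); apply: le_measure => //.
      + by rewrite inE; exact: measurableI.
      + by rewrite inE.
  move=> hlt; rewrite -lerBlDl (le_trans h4)//.
  have <- : e * (b - a) + e = eps.
    by rewrite -[X in _ + X]mulr1 -mulrDr divfK// gt_eqF.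
  by rewrite lerD2l ltW.
apply: real_induction ab _ _.
  exists 0%N, (fun=> 0), (fun=> 0); split => //; rewrite !big_geq ?measure_ge0//.
  by rewrite !subrr mulr0 addr0.
move=> s /andP[as_ sb].
(* An exceptional s has a neighbourhood inside the open set U; at any other s the derivative bounds
   the slope. *)
have [eta eta0 heta] : exists2 eta, 0 < eta & forall p q, s - eta < p -> p <= s ->
    s <= q -> q < s + eta -> f q - f p <= e * (q - p) \/ `[p, q] `<=` U.
  have [Ns|Ns] := pselect (N s).
    have /nbhs_ballP[eta /= eta0 heta] : nbhs s U by exact: open_nbhs_nbhs (conj oU (NU _ Ns)).
    exists eta => // p q sp ps sq qs; right => t /=; rewrite in_itv/= => /andP[pt tq].
    by apply: heta; rewrite /ball/= ltr_distlC; apply/andP; split; lra.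
  have [d fd d0] : exists2 d : R, is_derive s (1 : R) f d & d <= 0.
    by apply: contrapT => H; apply: Ns; exact: hN.
  have [eta eta0 heta] := derive_le0_local fd d0 e0.
  by exists eta => // p q *; left; exact: heta.
exists eta => // p q ap sp ps sq qs qb [k [al [be [h1 h2 h3 h4]]]].
have pq : p <= q by exact: le_trans sq.
have [fpq|pqU] := heta p q sp ps sq qs.
  exists k, al, be; split => //.
  - by move=> i /h1[? ? ?]; split => //; exact: le_trans pq.
  - apply: le_trans h3 _; apply: le_measure; rewrite ?inE; [exact: measurableI..|].
    by apply: setIS => t /=; rewrite !in_itv/= => /andP[-> /lt_le_trans]; exact.
  - have := lerD fpq h4; set Z := \sum_(0 <= _ < _) _; lra.
exists k.+1, (fun i => if (i < k)%N then al i else p),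
  (fun i => if (i < k)%N then be i else q); split.
- move=> i _; case: ifPn => [/h1[? ? ?]|_]; split => //; exact: le_trans pq.
- move=> i j ij jk; have ik : (i < k)%N by exact: leq_trans ij jk.
  by rewrite ik; case: ifPn => [|_]; [exact: h2|case: (h1 i ik)].
- rewrite big_nat_recr//= ltnn EFinD.
  have -> : U `&` `[a, q[ = (U `&` `[a, p[) `|` `[p, q[.
    apply/seteqP; split => t /=; rewrite !in_itv/=.
      move=> [Ot /andP[at_ tq]]; have [tp|pt] := ltP t p; first by left; rewrite at_.
      by right; rewrite tq.
    move=> [[Ot /andP[-> tp]]|/andP[pt tq]]; first by rewrite (lt_le_trans tp).
    rewrite tq (le_trans ap pt); split => //; apply: pqU => /=.
    by rewrite in_itv/= pt ltW.
  rewrite measureU//; [|exact: measurableI|].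
    apply: leeD; last first.
      rewrite /mu/= lebesgue_measure_itv/= lte_fin.
      by case: ltP => // qp; rewrite lee_fin subr_le0.
    apply: le_trans h3; rewrite lee_fin le_eqVlt; apply/orP; left; apply/eqP.
    by apply: eq_big_nat => i /andP[_ ->].
  rewrite -subset0 => t /= [[_]]; rewrite !in_itv/= => /andP[_ tp] /andP[pt _].
  by have := lt_le_trans tp pt; rewrite ltxx.
- rewrite big_nat_recr//= ltnn.
  rewrite (@eq_big_nat _ _ _ _ _ _ (fun i => `|f (be i) - f (al i)|)); last first.
    by move=> i /andP[_ ->].
  have := ler_norm (f q - f p); have : 0 <= e * (q - p) by rewrite mulr_ge0 ?subr_ge0// ltW.
  move: h4; set Z := \sum_(0 <= _ < _) _; lra.
Qed.

(** A common comparison principle from which products, sums and coordinates are treated. *)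
Lemma ac_le2 (V V1 V2 : normedModType R) (f : R -> V) (g : R -> V1) (h : R -> V2) :
  locally_absolutely_continuous g -> locally_absolutely_continuous h ->
  (forall c d, exists2 K, 0 <= K & forall a b, c <= a -> a <= b -> b <= d ->
     `|f b - f a| <= K * (`|g b - g a| + `|h b - h a|)) ->
  locally_absolutely_continuous f.
Proof.
move=> acg ach fgh c d eps eps0; have [K K0 hK] := fgh c d.
pose e := eps / (2 * (K + 1)).
have K1 : 0 < K + 1 by rewrite ltr_wpDl.
have e0 : 0 < e by rewrite divr_gt0// mulr_gt0.
have [d1 d10 h1] := acg c d e e0; have [d2 d20 h2] := ach c d e e0.
exists (Num.min d1 d2) => [|k a b hab tab]; first by rewrite lt_min d10.
rewrite lt_min => /andP[s1 s2].
have {}h1 := h1 k a b hab tab s1; have {}h2 := h2 k a b hab tab s2.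
apply: (@le_lt_trans _ _ (K * (\sum_(i < k) `|g (b i) - g (a i)| +
    \sum_(i < k) `|h (b i) - h (a i)|))).
  rewrite -big_split /= mulr_sumr; apply: ler_sum => i _.
  by case: (hab i) => *; exact: hK.
have H : (K + 1) * (e + e) = eps by rewrite /e; field; rewrite gt_eqF.
set x := \sum_(i < k) _ in h1 *; set y := \sum_(i < k) _ in h2 *.
have x0 : 0 <= x by apply: sumr_ge0.
have y0 : 0 <= y by apply: sumr_ge0.
by rewrite -H; nra.
Qed.

Lemma ac_continuous (V : normedModType R) (f : R -> V) :
  locally_absolutely_continuous f -> continuous f.
Proof.
move=> acf t; apply/cvgrPdist_lt => e e0.
have [delta delta0 hd] := acf (t - 1) (t + 1) e e0.
have key a b : t - 1 <= a -> a <= b -> b <= t + 1 -> b - a < delta -> `|f b - f a| < e.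
  move=> ta ab bt bad; have := hd 1%N (fun=> a) (fun=> b) (fun=> And3 ta ab bt).
  rewrite !big_ord1; apply => //; apply/trivIsetP => i j _ _.
  by rewrite (ord1 i) (ord1 j) eqxx.
near=> s.
have st : `|t - s| < Num.min 1 delta.
  near: s; apply/nbhs_ballP; exists (Num.min 1 delta) => //=.
  by rewrite lt_min ltr01.
move: st; rewrite lt_min => /andP[]; rewrite !ltr_distlC => /andP[s1 s2] /andP[s3 s4].
have [ts|st] := leP t s; [rewrite distrC|]; apply: key; lra.
Unshelve. all: by end_near. Qed.

Lemma ac_bounded (V : normedModType R) (f : R -> V) c d :
  locally_absolutely_continuous f ->
  exists2 K, 0 <= K & forall t, c <= t <= d -> `|f t| <= K.
Proof.
move=> /ac_continuous cf.
have [M [_ hM]] : bounded_set (f @` `[c, d]).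
  apply: compact_bounded; apply: continuous_compact; last exact: segment_compact.
  exact: continuous_subspaceT.
exists (`|M| + 1) => [|t tcd]; first by rewrite addr_ge0.
apply: hM; first by rewrite ltr_pwDr// ler_norm.
by exists t => //=; rewrite in_itv.
Qed.

Lemma acM (f g : R -> R^o) : locally_absolutely_continuous f ->
  locally_absolutely_continuous g ->
  locally_absolutely_continuous (fun t => f t * g t : R^o).
Proof.
move=> acf acg; apply: (ac_le2 acf acg) => c d.
have [K K0 hK] := ac_bounded c d acf; have [L L0 hL] := ac_bounded c d acg.
exists (K + L) => [|a b ca ab bd]; first by rewrite addr_ge0.
have fb : `|f b| <= K by apply: hK; rewrite (le_trans ca).
have ga : `|g a| <= L by apply: hL; rewrite ca (le_trans ab).
have -> : f b * g b - f a * g a = f b * (g b - g a) + (f b - f a) * g a by ring.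
rewrite (le_trans (ler_normD _ _))// !normrM mulrDl !mulrDr.
have [x0 y0] := (normr_ge0 (f b - f a), normr_ge0 (g b - g a)).
set x := `|f b - f a| in x0 *; set y := `|g b - g a| in y0 *.
have : `|f b| * y <= K * y by exact: ler_wpM2r.
have : x * `|g a| <= x * L by exact: ler_wpM2l.
have : 0 <= K * x by exact: mulr_ge0.
have : 0 <= L * y by exact: mulr_ge0.
by rewrite (mulrC x L); lra.
Qed.

Lemma acD (V : normedModType R) (f g : R -> V) : locally_absolutely_continuous f ->
  locally_absolutely_continuous g ->
  locally_absolutely_continuous (fun t => f t + g t).
Proof.
move=> acf acg; apply: (ac_le2 acf acg) => c d; exists 1 => // a b _ _ _.
by rewrite mul1r opprD addrACA ler_normD.
Qed.

Lemma ac_cst (V : normedModType R) (v : V) :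
  locally_absolutely_continuous (fun _ : R => v).
Proof.
move=> c d e e0; exists 1 => // k a b _ _ _; rewrite big1// => i _.
by rewrite subrr normr0.
Qed.

Lemma ac_sum (V : normedModType R) k (f : 'I_k -> R -> V) :
  (forall i, locally_absolutely_continuous (f i)) ->
  locally_absolutely_continuous (fun t => \sum_(i < k) f i t).
Proof.
elim: k f => [|k IHk] f acf.
  have -> : (fun t => \sum_(i < 0) f i t) = fun=> 0.
    by apply/funext => t; rewrite big_ord0.
  exact: ac_cst.
have -> : (fun t => \sum_(i < k.+1) f i t) =
    fun t => \sum_(i < k) f (widen_ord (leqnSn k) i) t + f ord_max t.
  by apply/funext => t; rewrite big_ord_recr.
by apply: acD => //; exact: IHk.
Qed.

Lemma ac_coord k (X : R -> 'cV[R]_k) i : locally_absolutely_continuous X ->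
  locally_absolutely_continuous (fun t => X t i 0 : R^o).
Proof.
move=> acX; apply: (ac_le2 acX acX) => c d; exists 1 => // a b _ _ _.
rewrite mul1r; apply: (@le_trans _ _ `|X b - X a|); last by rewrite lerDl.
rewrite [leRHS]/Num.norm/= mx_normrE.
have -> : X b i 0 - X a i 0 = (X b - X a) i 0 by rewrite !mxE.
exact: (le_bigmax _ (fun ij : 'I_k * 'I_1 => `|(X b - X a) ij.1 ij.2|) (i, 0)).
Qed.

(* The energy exp(-ct) |P X|^2 is nonincreasing for c large. *)
Lemma ae_linear_ode_zero k n (X DX : R -> 'cV[R]_k) (P : 'M[R]_(n, k)) (M : 'M[R]_n) T :
  locally_absolutely_continuous X ->
  {ae (@lebesgue_measure R), forall t : R,
     is_derive t (1 : R) X (DX t) /\ P *m DX t = M *m (P *m X t)} ->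
  0 <= T -> P *m X 0 = 0 -> P *m X T = 0.
Proof.
move=> acX ode T0 PX0.
pose x i t : R := (P *m X t) i 0.
pose dx i t : R := (P *m DX t) i 0.
pose S t : R := \sum_i x i t * x i t.
(* With S = |P X|^2, S' is the sum of 2 M_ij x_i x_j, and |x_i x_j| <= S gives S' <= c S. *)
pose c : R := \sum_i \sum_j `|M i j| * 2.
pose f t : R := expR (- c * t) * S t.
have S_ge0 t : 0 <= S t by apply: sumr_ge0 => i _; rewrite -expr2 sqr_ge0.
have acx i : locally_absolutely_continuous (x i : R -> R^o).
  have -> : x i = fun t => \sum_j P i j * X t j 0.
    by apply/funext => t; rewrite /x mxE.
  apply: ac_sum => j; apply: acM; [exact: ac_cst|exact: ac_coord].
have dexp (t : R) : is_derive t (1 : R) (fun s : R => expR (- c * s)) (expR (- c * t) * - c).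
  apply: (@is_derive1_comp R expR (fun s => - c * s)).
  have -> : (fun s : R => - c * s) = - c \*: id by [].
  by apply: is_derive_eq; rewrite /GRing.scale/= mulr1.
have acf : locally_absolutely_continuous (f : R -> R^o).
  apply: acM; last by apply: ac_sum => i; exact: acM.
  apply: lipschitz_ac => a b; apply: (C1_lipschitz a b dexp).
  move=> t; apply: cvgM; last exact: cvg_cst.
  have ce : {for t, continuous (fun s : R => expR (- c * s))}.
    apply/differentiable_continuous/derivable1_diffP.
    exact: (@ex_derive _ _ _ _ _ _ _ (dexp t)).
  exact: ce.
have f_nonincr : f T <= f 0.
  apply: ac_ae_nonincreasing => //; case: ode => N [mN N0 hN].
  exists N; split => // t ft; apply: hN => -[Xt PDX]; apply: ft => /=.
  have dX j : is_derive t (1 : R) (fun s => X s j 0 : R) (DX t j 0).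
    have der : derivable X t (1 : R) := @ex_derive _ _ _ _ _ _ _ Xt.
    apply: DeriveDef; first exact: (derivable_mxP _ _ _).1 der j 0.
    by rewrite -(@derive_val _ _ _ _ _ _ _ Xt) derive_mx// mxE.
  have dxt i : is_derive t (1 : R) (x i) (dx i t).
    have -> : x i = \sum_(j < k) (P i j \*: (fun s => X s j 0 : R)).
      by apply/funext => s; rewrite fct_sumE /x mxE.
    have -> : dx i t = \sum_(j < k) (P i j *: (DX t j 0 : R)) by rewrite /dx mxE.
    by apply: is_derive_sum => j; exact: is_deriveZ.
  have dS : is_derive t (1 : R) S (\sum_i (x i t * dx i t) * 2).
    have -> : S = \sum_i (x i * x i) by apply/funext => s; rewrite fct_sumE.
    apply: is_derive_sum => i; apply: is_derive_eq.
    by rewrite /GRing.scale/=; ring.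
  exists (expR (- c * t) * (\sum_i (x i t * dx i t) * 2) + S t * (expR (- c * t) * - c)).
    exact: (@is_deriveM _ _ (fun s => expR (- c * s)) S).
  have -> : expR (- c * t) * (\sum_i x i t * dx i t * 2) + S t * (expR (- c * t) * - c) =
      expR (- c * t) * (\sum_i x i t * dx i t * 2 - c * S t) by ring.
  rewrite pmulr_rle0 ?expR_gt0// subr_le0 /c mulr_suml; apply: ler_sum => i _.
  rewrite /dx PDX mxE -/(x _ _) mulr_sumr !mulr_suml; apply: ler_sum => j _.
  rewrite -/(x j t).
  have xS q : x q t * x q t <= S t.
    rewrite /S (bigD1 q)//= lerDl sumr_ge0// => r _; by rewrite -expr2 sqr_ge0.
  have xij : `|x i t * x j t| <= S t.
    have := xS i; have := xS j; rewrite ler_norml; move: (x i t) (x j t) => y z ? ?.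
    by apply/andP; split; nra.
  rewrite [leLHS](_ : _ = M i j * (x i t * x j t) * 2); last by ring.
  rewrite [leRHS](_ : _ = `|M i j| * S t * 2); last by ring.
  by rewrite ler_wpM2r// (le_trans (ler_norm _))// normrM ler_wpM2l.
have f0 : f 0 = 0.
  by rewrite /f /S big1 ?mulr0// => i _; rewrite /x PX0 mxE mulr0.
have ST : S T = 0.
  apply/eqP; rewrite eq_le S_ge0 andbT -(pmulr_rle0 _ (expR_gt0 (- c * T))).
  by rewrite -f0.
apply/matrixP => i j; rewrite (ord1 j) [RHS]mxE.
have xx0 q : true -> 0 <= x q T * x q T by rewrite -expr2 sqr_ge0.
have /eqP : x i T * x i T = 0 by exact: psumr_eq0P xx0 ST _ _.
by rewrite mulf_eq0 orbb => /eqP.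
Qed.

End AbsolutelyContinuous.

(** * Genericity *)

(** [ae_linear_ode_zero] applies to X = E x with P = L and M = L A. Hence no trajectory leads from 0
    to the all-ones vector, which is nonzero since n is positive. *)
Lemma left_invertible_not_controllable (R : realType) l n m
    (E A : 'M[R]_(l, n)) (B : 'M[R]_(l, m)) (L : 'M[R]_(n, l)) : (0 < n)%N ->
  L *m E = 1%:M -> L *m B = 0 -> ~ completely_controllable (E, A, B).
Proof.
move=> n0 LE LB [T T0 /(_ 0 (const_mx 1))[x [u [[_ _ acE ode] x0 xT]]]].
have LEx t : L *m (E *m x t) = x t by rewrite mulmxA LE mul1mx.
have : L *m (E *m x T) = 0.
  apply: (ae_linear_ode_zero (DX := fun t => A *m x t + B *m u t)
    (M := L *m A) acE _ (ltW T0)).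
    case: ode => N [mN N0 hN]; exists N; split => // t ft; apply: hN => /= dt; apply: ft => /=.
    split => //; by rewrite LEx mulmxDr !mulmxA LB mul0mx addr0.
  by rewrite LEx.
rewrite LEx xT => /matrixP/(_ (Ordinal n0) 0); rewrite !mxE => /eqP.
by rewrite oner_eq0.
Qed.

Lemma meval_line (R : comNzRingType) N (p : mpoly N R) (v w : 'rV[R]_N) :
  exists P : {poly R}, forall t, P.[t] = meval ((v + t *: w) 0) p.
Proof.
exists (\sum_(a <- msupp p)
  (mcoeff a p)%:P * \prod_i ((v 0 i)%:P + 'X * (w 0 i)%:P) ^+ a i) => t.
rewrite mevalE horner_sum; apply: eq_bigr => a _.
rewrite hornerM hornerC horner_prod; congr (_ * _); apply: eq_bigr => i _.
by rewrite horner_exp !hornerE !mxE.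
Qed.

Lemma poly_nonroot (F : numFieldType) (p : {poly F}) : p != 0 -> exists t, p.[t] != 0.
Proof.
move=> p0; apply: contrapT => H.
(* In characteristic zero these are [size p] distinct points, one more than the degree allows as
   roots. *)
have rs : all (root p) [seq i%:R | i <- iota 0 (size p)].
  apply/allP => t _; apply/rootP; apply: contrapT => /eqP pt; apply: H; by exists t.
have us : uniq [seq i%:R : F | i <- iota 0 (size p)].
  by rewrite map_inj_uniq ?iota_uniq// => i j /eqP; rewrite eqr_nat => /eqP.
by have := max_poly_roots p0 rs us; rewrite size_map size_iota ltnn.
Qed.

Section Entries.
Variables (T : Type) (l n m : nat).
Implicit Types v : 'rV[T]_(l * n + l * n + l * m).

(** The three maps together invert [Sigma_vec]. The entry type is arbitrary so that they also apply
    to a row of indeterminates. *)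
Definition entries_E v : 'M[T]_(l, n) := vec_mx (lsubmx (lsubmx v)).
Definition entries_A v : 'M[T]_(l, n) := vec_mx (rsubmx (lsubmx v)).
Definition entries_B v : 'M[T]_(l, m) := vec_mx (rsubmx v).

End Entries.

Lemma entriesK (R : realType) l n m (s : Sigma R l n m) :
  (entries_E (Sigma_vec s), entries_A (Sigma_vec s), entries_B (Sigma_vec s)) = s.
Proof.
case: s => [[E A] B]; rewrite /entries_E /entries_A /entries_B /Sigma_vec /=.
by rewrite !(row_mxKl, row_mxKr) !mxvecK.
Qed.

Lemma Sigma_vecK (R : realType) l n m (v : 'rV[R]_(l * n + l * n + l * m)) :
  Sigma_vec (entries_E v, entries_A v, entries_B v) = v.
Proof. by rewrite /Sigma_vec /= !vec_mxK !hsubmxK. Qed.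

Lemma generic_controllable (R : realType) l n m : (0 < n)%N -> (l < m + n)%N ->
  generic (@Sigma_vec R l n m @` [set s | completely_controllable s]).
Proof.
move=> n0 lmn; set N := (l * n + l * n + l * m)%N.
(* The generic point: its coordinates are the indeterminates, so q is the determinant as a
   polynomial in the entries of the system. *)
pose g : 'rV[mpoly N R]_N := \row_i mpolyX R (mnm1 i).
pose q := x_coef_det (entries_E g) (entries_A g) (entries_B g).
have qE (v : 'rV[R]_N) : meval (v 0) q = x_coef_det (entries_E v) (entries_A v) (entries_B v).
  have gv : map_mx (meval (v 0)) g = v.
    by apply/rowP => i; rewrite !mxE mevalXU.
  rewrite map_x_coef_det /entries_E /entries_A /entries_B.
  by rewrite !map_vec_mx !(map_lsubmx, map_rsubmx) gv.
exists [set v : 'rV[R]_N | forall i : 'I_1, meval (v 0) q = 0]; split.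
- by exists 1%N, (fun=> q).
- have [E [A [B EAB]]] := x_coef_det_neq0 R n0 lmn.
  move=> /seteqP[_ /(_ (Sigma_vec (E, A, B)) I)/(_ ord0)/eqP].
  rewrite qE; have [-> -> ->] := entriesK (E, A, B).
  exact/negP.
- move=> v Sv i; apply: contrapT => /eqP; rewrite qE => det0; apply: Sv.
  exists (entries_E v, entries_A v, entries_B v); last exact: Sigma_vecK.
  have [d [nd d0]] := image_col_coef_finite (entries_E v) (entries_A v) (entries_B v).
  apply: (image_representation_controllable (fun j => x_coef_rec _ _ _ j lmn) nd d0).
  exact: det0.
Qed.

Lemma not_generic_controllable (R : realType) l n m : (0 < n)%N -> (n + m <= l)%N ->
  ~ generic (@Sigma_vec R l n m @` [set s | completely_controllable s]).
Proof.
move=> n0 nml [V [[k [p VE]] VT VS]]; apply: VT; rewrite -subTset => v0 _.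
rewrite VE => i /=; apply: contrapT => /eqP pv0.
pose Q : 'M[R]_(n + m, l) := pid_mx (n + m).
pose I0 : 'M[R]_(l, n + m) := pid_mx (n + m).
(* Here [E, B] is I0, whose first n + m rows form the identity. *)
pose v1 : 'rV[R]_(l * n + l * n + l * m) :=
  Sigma_vec (lsubmx I0, 0 : 'M[R]_(l, n), rsubmx I0).
(* M v consists of the first n + m rows of [E, B]; its invertibility yields a left inverse. It is
   linear in v, so its determinant along a line is a polynomial in t. *)
pose M (v : 'rV[R]_(l * n + l * n + l * m)) := Q *m row_mx (entries_E v) (entries_B v).
have Mline t w : M (v0 + t *: w) = M v0 + t *: M w.
  rewrite /M /entries_E /entries_B !linearD !linearZ/=.
  by rewrite -add_row_mx -scale_row_mx mulmxDr scalemxAr.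
have Mv1 : M v1 = 1%:M.
  rewrite /M; have [-> _ ->] := entriesK (lsubmx I0, 0 : 'M[R]_(l, n), rsubmx I0).
  by rewrite hsubmxK pid_mx_id// pid_mx_1.
have [P PE] := meval_line (p i) v0 (v1 - v0).
pose D := \det (map_mx polyC (M v0) + 'X *: map_mx polyC (M (v1 - v0))).
have DE t : D.[t] = \det (M (v0 + t *: (v1 - v0))).
  rewrite -[LHS]/(horner_eval t D) -det_map_mx Mline; congr (\det _).
  move: (M v0) (M (v1 - v0)) => M0 M1; apply/matrixP => a b.
  by rewrite !mxE /= /horner_eval !hornerE.
have P0 : P != 0.
  by apply: contraNneq pv0 => P0; have := PE 0; rewrite P0 horner0 scale0r addr0 => <-.
have D0 : D != 0.
  apply/eqP => D0; have := DE 1; rewrite D0 horner0 scale1r addrC subrK Mv1 det1.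
  by move/eqP; rewrite eq_sym oner_eq0.
(* P is nonzero at t = 0 and D at t = 1, so some t is a root of neither. *)
have [t] := poly_nonroot (mulf_neq0 P0 D0).
rewrite hornerM mulf_eq0 negb_or PE DE; set v := v0 + _ => /andP[pv Mv].
have uM : M v \in unitmx by rewrite unitmxE unitfE.
pose L := usubmx (invmx (M v) *m Q).
have LEB : L *m row_mx (entries_E v) (entries_B v) = row_mx 1%:M 0.
  rewrite /L mul_usub_mx -mulmxA mulVmx// scalar_mx_block block_mxEv.
  by rewrite col_mxKu.
move: LEB; rewrite mul_mx_row => /eq_row_mx[LE LB].
suff : V v by rewrite VE => /(_ i)/eqP; exact/negP.
apply: VS => -[s sC vs]; have := entriesK s; rewrite vs => es.
move: sC => /=; rewrite -es.
exact: left_invertible_not_controllable n0 LE LB.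
Qed.

Theorem proposition5p11 (R : realType) (l n m : nat)
    (hl : (0 < l)%N) (hn : (0 < n)%N) (hm : (0 < m)%N) :
  generic (@Sigma_vec R l n m @` [set s | completely_controllable s])
  <-> (l < n + m)%N.
Proof.
split=> [gen|lnm]; last by apply: generic_controllable; rewrite // addnC.
by rewrite ltnNge; apply/negP => /(not_generic_controllable hn)/(_ gen).
Qed.
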